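(* Let $A$ be a prime Goldie $\mathsf{k}$-algebra and $G$ a finite group of automorphisms of $A$. Suppose that either the trace of $G$ on $A$ is nondegenerate, or $A$ has no nonzero nilpotent elements. Suppose also that $B=A^G$ is a prime Goldie ring. Then $LD\,A=LD\,B$, and if $A$ is $LD$-stable then so is $B$.
   Context: $\mathsf{k}$ is a field of characteristic zero. $A^G=\{a\in A: g(a)=a\ \forall g\in G\}$. The trace is $\operatorname{tr}(a)=\sum_{g\in G}g(a)$; it is nondegenerate if $\operatorname{tr}(aA)\neq0$ for every nonzero $a\in A$. $GK$ is Gelfand–Kirillov dimension: $GK\,R=\sup_V\limsup_m\log(\dim V^m)/\log m$ over subframes $V$ (finite-dimensional subspaces containing $1$). Lower transcendence degree $LD$: if every subframe $V$ admits a finite-dimensional nonzero $W$ with $\dim VW=\dim W$, then $LD\,R=0$; otherwise $LD\,R=\sup_V\sup\{d>0:\exists c>0,\ \dim VW\ge\dim W+c(\dim W)^{(d-1)/d}\text{ for all finite-dimensional }W\neq0\}$. $R$ is $LD$-stable if $LD\,R=GK\,R$. *)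

(* Defs.v *)
From HB Require Import structures.
From mathcomp Require Import all_boot all_order all_algebra all_fingroup.
From mathcomp Require Import all_classical all_reals all_analysis.
From mathcomp Require Import Rstruct.
Set Implicit Arguments. Unset Strict Implicit. Unset Printing Implicit Defensive.
Import Order.TTheory GRing.Theory Num.Theory.
Local Open Scope ring_scope.

Notation RR := Rdefinitions.R.

Section AlgebraDefs.
Variables (k : fieldType) (A : algType k).

(* ---------- finite-dimensional subspaces, given by finite spanning lists ---------- *)

Definition lin_indep (l : seq A) : Prop :=
  forall c : 'I_(size l) -> k,
    \sum_(i < size l) c i *: l`_i = 0 -> forall i, c i = 0.

Definition in_span (l : seq A) (x : A) : Prop :=
  exists c : 'I_(size l) -> k, x = \sum_(i < size l) c i *: l`_i.

(* dimension of the k-span of l = maximal size of a linearly independent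
   subfamily of l *)
Definition sdim (l : seq A) : nat :=
  \max_(m : (size l).-tuple bool | `[< lin_indep (mask m l) >]) size (mask m l).

Definition vmul (v w : seq A) : seq A := [seq x * y | x <- v, y <- w].

Fixpoint vpow (v : seq A) (m : nat) : seq A :=
  if m is m'.+1 then vmul (vpow v m') v else [:: 1].

Definition subalg (S : A -> Prop) : Prop :=
  [/\ S 1, forall x y, S x -> S y -> S (x + y), forall x y, S x -> S y -> S (x * y)
    & forall (c : k) x, S x -> S (c *: x)].

Definition subframe (S : A -> Prop) (v : seq A) : Prop :=
  (forall x, x \in v -> S x) /\ in_span v 1.

Definition nz_fdsub (S : A -> Prop) (w : seq A) : Prop :=
  (forall x, x \in w -> S x) /\ (0 < sdim w)%N.

Definition GKdim (S : A -> Prop) : \bar RR :=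
  ereal_sup [set limn_esup (fun m : nat =>
                 ((ln (sdim (vpow v m))%:R / ln (m%:R : RR))%:E))
            | v in subframe S].

Definition LD_exps (S : A -> Prop) (v : seq A) : set RR :=
  [set d : RR | 0 < d /\ exists c : RR, 0 < c /\
     forall w, nz_fdsub S w ->
       (sdim w)%:R + c * ((sdim w)%:R `^ ((d - 1) / d)) <= (sdim (vmul v w))%:R].

Definition LDdeg (S : A -> Prop) : \bar RR :=
  if `[< forall v, subframe S v ->
           exists w, nz_fdsub S w /\ sdim (vmul v w) = sdim w >]
  then 0%E
  else ereal_sup [set ereal_sup [set d%:E | d in LD_exps S v] | v in subframe S].

Definition LD_stable (S : A -> Prop) : Prop := LDdeg S = GKdim S.

Definition prime_ring (S : A -> Prop) : Prop :=
  forall a b, S a -> S b -> (forall r, S r -> a * r * b = 0) -> a = 0 \/ b = 0.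

Definition set_eq (X Y : A -> Prop) : Prop := forall x, X x <-> Y x.
Definition set_sub (X Y : A -> Prop) : Prop := forall x, X x -> Y x.

Definition rann (S X : A -> Prop) : A -> Prop :=
  fun s => S s /\ forall x, X x -> x * s = 0.
Definition lann (S X : A -> Prop) : A -> Prop :=
  fun s => S s /\ forall x, X x -> s * x = 0.

Definition acc_rann (S : A -> Prop) : Prop :=
  forall X : nat -> (A -> Prop), (forall n, set_sub (X n) S) ->
    (forall n, set_sub (rann S (X n)) (rann S (X n.+1))) ->
    exists N, forall n, (N <= n)%N -> set_eq (rann S (X n)) (rann S (X N)).
Definition acc_lann (S : A -> Prop) : Prop :=
  forall X : nat -> (A -> Prop), (forall n, set_sub (X n) S) ->
    (forall n, set_sub (lann S (X n)) (lann S (X n.+1))) ->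
    exists N, forall n, (N <= n)%N -> set_eq (lann S (X n)) (lann S (X N)).

Definition right_ideal (S I : A -> Prop) : Prop :=
  [/\ set_sub I S, I 0, forall x y, I x -> I y -> I (x + y)
    & forall x r, I x -> S r -> I (x * r)].
Definition left_ideal (S I : A -> Prop) : Prop :=
  [/\ set_sub I S, I 0, forall x y, I x -> I y -> I (x + y)
    & forall x r, I x -> S r -> I (r * x)].

Definition indep_family (I : nat -> (A -> Prop)) : Prop :=
  forall (n : nat) (x : nat -> A), (forall i, (i < n)%N -> I i (x i)) ->
    \sum_(i < n) x i = 0 -> forall i, (i < n)%N -> x i = 0.

Definition nonzero_set (I : A -> Prop) : Prop := exists x, I x /\ x <> 0.

Definition fin_rudim (S : A -> Prop) : Prop :=
  ~ exists I : nat -> (A -> Prop),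
      (forall n, right_ideal S (I n) /\ nonzero_set (I n)) /\ indep_family I.
Definition fin_ludim (S : A -> Prop) : Prop :=
  ~ exists I : nat -> (A -> Prop),
      (forall n, left_ideal S (I n) /\ nonzero_set (I n)) /\ indep_family I.

Definition right_goldie (S : A -> Prop) : Prop := acc_rann S /\ fin_rudim S.
Definition left_goldie (S : A -> Prop) : Prop := acc_lann S /\ fin_ludim S.
Definition goldie (S : A -> Prop) : Prop := right_goldie S /\ left_goldie S.

Definition prime_goldie (S : A -> Prop) : Prop := prime_ring S /\ goldie S.

Definition whole : A -> Prop := fun _ => True.

(* act : gT -> A -> A is a faithful action of the finite group gT on A by
   k-algebra automorphisms, i.e. gT is (isomorphic to) a finite group of
   automorphisms of A. *)
Definition faithful_alg_action (gT : finGroupType) (act : gT -> A -> A) : Prop :=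
  [/\ forall g, zmod_morphism (act g) /\ scalable (act g)
                /\ (forall x y, act g (x * y) = act g x * act g y) /\ act g 1 = 1,
      forall x, act 1%g x = x,
      forall g h x, act (g * h)%g x = act g (act h x)
    & forall g h, act g =1 act h -> g = h].

Definition fixed_ring (gT : finGroupType) (act : gT -> A -> A) : A -> Prop :=
  fun a => forall g, act g a = a.

Definition trace (gT : finGroupType) (act : gT -> A -> A) (a : A) : A :=
  \sum_(g : gT) act g a.

Definition trace_nondeg (gT : finGroupType) (act : gT -> A -> A) : Prop :=
  forall a, a != 0 -> exists x, trace act (a * x) != 0.

Definition reduced : Prop := forall a : A, forall n, a ^+ n = 0 -> a = 0.

End AlgebraDefs.
Arguments whole [k] A _.

(* Main.v *)
(* A prime ring of characteristic zero has no nonzero one-sided ideal that is G-stable and traceless (Bergman-Isaacs), so the trace form [tr (x y)] is nondegenerate on both sides. Put B = A^G.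
   Dimension estimates pass from B to A because the maps [a |-> tr (a x)] are left B-linear with values in B and separate the points of A.
   They pass from A to B because A_B has finite uniform dimension: finitely many maps [a |-> tr (x a)] separate the points of A, so some finitely generated M = sum_i a_i B is essential in A_B, and by Goldie's lemma any finite subset of A is carried into M by right multiplication by an element of B that is left regular in B.
   Stability follows from LD B <= GK B <= GK A. *)
Require Import Defs.
From HB Require Import structures.
From mathcomp Require Import all_boot all_order all_algebra all_fingroup.
From mathcomp Require Import all_classical all_reals all_analysis.
From mathcomp Require Import Rstruct ring lra.
Set Implicit Arguments. Unset Strict Implicit. Unset Printing Implicit Defensive.
Import Order.TTheory GRing.Theory Num.Theory.
Local Open Scope ring_scope.

(** * Dimensions of spans *)

Section Dimension.
Variables (k : fieldType) (A : algType k).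
Implicit Types (l b : seq A) (x y z : A).

(** No quotient ring is formed. Finiteness rests on one principle: if a module has an infinite
    independent sequence, finitely many right linear maps into a ring of finite uniform dimension
    cannot separate its points. It is used twice, over different rings: over A, for A^|G|, to obtain
    finitely many separating traces, and over B, for A itself, to obtain M. The sequences are chosen
    greedily; the obstacle is that an element of B may kill less than its square does, so it is
    first replaced by a multiple with the same right annihilator as its square. Both comparisons of
    LD use that (d-1)/d lies between 0 and 1, so exponents below 1 are traded for 1. The bound LD <=
    GK is a discrete differential inequality for the dimensions of the powers of V. *)

Lemma in_span_nil x : in_span [::] x <-> x = 0.
Proof.
split=> [[c ->]|->]; first by rewrite big_ord0.
by exists (fun=> 0); rewrite big_ord0.
Qed.

Lemma in_span_cons y l x :
  in_span (y :: l) x <-> exists a z, in_span l z /\ x = a *: y + z.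
Proof.
split=> [[c ->]|[a [z [[c ->] ->]]]].
  exists (c ord0), (\sum_(i < size l) c (lift ord0 i) *: l`_i).
  by rewrite big_ord_recl; split=> //; exists (fun i => c (lift ord0 i)).
exists (fun i : 'I_(size l).+1 => oapp c a (unlift ord0 i)).
rewrite big_ord_recl unlift_none /=; congr (_ + _).
by apply: eq_bigr => i _; rewrite liftK.
Qed.

Lemma in_span0 l : in_span l 0.
Proof.
elim: l => [|y l IH]; first exact/in_span_nil.
by apply/in_span_cons; exists 0, 0; rewrite scale0r addr0.
Qed.

Lemma in_spanD l x y : in_span l x -> in_span l y -> in_span l (x + y).
Proof.
elim: l x y => [x y /in_span_nil-> /in_span_nil->|t l IH x y].
  by apply/in_span_nil; rewrite addr0.
move=> /in_span_cons[a [z [lz ->]]] /in_span_cons[a' [z' [lz' ->]]].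
apply/in_span_cons; exists (a + a'), (z + z'); split; first exact: IH.
by rewrite scalerDl addrACA.
Qed.

Lemma in_spanZ l a x : in_span l x -> in_span l (a *: x).
Proof.
elim: l x => [x /in_span_nil->|t l IH x]; first by rewrite scaler0; exact/in_span_nil.
move=> /in_span_cons[a' [z [lz ->]]].
apply/in_span_cons; exists (a * a'), (a *: z); split; first exact: IH.
by rewrite scalerDr scalerA.
Qed.

Lemma in_spanB l x y : in_span l x -> in_span l y -> in_span l (x - y).
Proof. by move=> lx ly; rewrite -scaleN1r; apply/in_spanD/in_spanZ. Qed.

Lemma in_span_mem l x : x \in l -> in_span l x.
Proof.
elim: l => // y l IH; rewrite inE => /predU1P[->|/IH lx]; apply/in_span_cons.
  by exists 1, 0; split; [exact: in_span0 | rewrite scale1r addr0].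
by exists 0, x; rewrite scale0r add0r.
Qed.

Lemma in_span_trans l l' x :
  (forall y, y \in l -> in_span l' y) -> in_span l x -> in_span l' x.
Proof.
elim: l x => [x _ /in_span_nil->|y l IH x sub]; first exact: in_span0.
move=> /in_span_cons[a [z [lz ->]]]; apply: in_spanD.
  by apply/in_spanZ/sub/mem_head.
by apply: IH lz => t lt; apply: sub; rewrite inE lt orbT.
Qed.

Lemma in_span_subset l l' x : {subset l <= l'} -> in_span l x -> in_span l' x.
Proof. by move=> sub; apply: in_span_trans => y /sub/in_span_mem. Qed.

Lemma in_span_map (f : A -> A) l x :
  linear f -> in_span l x -> in_span (map f l) (f x).
Proof.
move=> fL; have f0 : f 0 = 0.
  by have := fL (-1) 0 0; rewrite scaler0 addr0 scaleN1r addNr.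
elim: l x => [x /in_span_nil->|y l IH x]; first exact/in_span_nil.
move=> /in_span_cons[a [z [lz ->]]]; apply/in_span_cons.
by exists a, (f z); split; [exact: IH|rewrite fL].
Qed.

Lemma in_span_closed (S : A -> Prop) l x : S 0 ->
  (forall y z, S y -> S z -> S (y + z)) -> (forall a y, S y -> S (a *: y)) ->
  (forall y, y \in l -> S y) -> in_span l x -> S x.
Proof.
move=> S0 SD SZ; elim: l x => [x _ /in_span_nil->//|y l IH x sub].
move=> /in_span_cons[a [z [lz ->]]]; apply: SD.
  by apply/SZ/sub/mem_head.
by apply: IH lz => t lt; apply: sub; rewrite inE lt orbT.
Qed.

Lemma lin_indep_nil : lin_indep ([::] : seq A).
Proof. by move=> c _ []. Qed.

Lemma lin_indep_cons y l : lin_indep (y :: l) <-> lin_indep l /\ ~ in_span l y.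
Proof.
split=> [ind|[ind nly] c].
  split=> [c c0 i|[c yE]].
    have := ind (fun i : 'I_(size l).+1 => oapp c 0 (unlift ord0 i)).
    rewrite big_ord_recl unlift_none /= scale0r add0r => /(_ _ (lift ord0 i)).
    rewrite liftK; apply; rewrite -[RHS]c0.
    by apply: eq_bigr => j _; rewrite liftK.
  have := ind (fun i : 'I_(size l).+1 => oapp c (-1) (unlift ord0 i)).
  rewrite big_ord_recl unlift_none /= => /(_ _ ord0); rewrite unlift_none /=.
  suff S : -1 *: y + \sum_(i < size l) oapp c (-1) (unlift ord0 (lift ord0 i)) *: l`_i = 0.
    by move=> /(_ S)/eqP; rewrite oppr_eq0 oner_eq0.
  rewrite {1}yE scaleN1r; apply/eqP; rewrite addrC subr_eq0; apply/eqP.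
  by apply: eq_bigr => j _; rewrite liftK.
rewrite /= big_ord_recl /= => c0.
have [c00|c00] := eqVneq (c ord0) 0.
  move: c0; rewrite c00 scale0r add0r => /(ind (fun i => c (lift ord0 i))) H i.
  by case: (unliftP ord0 i) => [j ->|->].
case: nly; exists (fun i => - (c ord0)^-1 * c (lift ord0 i)).
move/eqP: c0; rewrite addr_eq0 => /eqP/(congr1 (fun t => (c ord0)^-1 *: t)).
rewrite scalerA mulVf // scale1r => ->; rewrite scalerN -scaleNr scaler_sumr.
by apply: eq_bigr => i _; rewrite scalerA.
Qed.

Lemma lin_indep_leq l l' : lin_indep l ->
  (forall x, x \in l -> in_span l' x) -> (size l <= size l')%N.
Proof.
move=> ind sub; rewrite leqNgt; apply/negP => lt.
have /choice[C CE] (i : 'I_(size l)) : exists c : 'I_(size l') -> k,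
    l`_i = \sum_(j < size l') c j *: l'`_j by apply/sub/mem_nth.
pose M : 'M[k]_(size l, size l') := \matrix_(i, j) C i j.
(* [M] writes [l] in terms of [l']; having more rows than columns, it kills a nonzero row vector,
   which is a relation on [l]. *)
have : kermx M != 0.
  rewrite -mxrank_eq0 mxrank_ker subn_eq0 -ltnNge.
  exact: leq_ltn_trans (rank_leq_col M) lt.
case/rowV0Pn => u /sub_kermxP uM /eqP[]; apply/rowP => i; rewrite mxE.
apply: (ind (fun i => u 0 i)) => {i}.
under eq_bigr => i _ do rewrite CE scaler_sumr.
rewrite exchange_big big1 // => j _.
have /rowP/(_ j) := uM; rewrite !mxE => u0.
rewrite -[RHS](scale0r l'`_j) -u0 scaler_suml.
by apply: eq_bigr => i _; rewrite mxE scalerA.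
Qed.

Lemma lin_indep_extend b l : lin_indep b -> exists2 d,
  subseq d l & lin_indep (d ++ b) /\ forall x, x \in l -> in_span (d ++ b) x.
Proof.
move=> indb; elim: l => [|y l [d dl [ind sub]]].
  by exists [::].
case: (pselect (in_span (d ++ b) y)) => [dy|ndy].
  exists d; first exact: subseq_trans dl (subseq_cons l y).
  by split=> // x; rewrite inE => /predU1P[->//|/sub].
exists (y :: d); first by rewrite /= eqxx.
split; first exact/lin_indep_cons.
move=> x; rewrite inE => /predU1P[->|/sub dx]; first exact/in_span_mem/mem_head.
by apply: in_span_subset dx => t; rewrite inE => ->; rewrite orbT.
Qed.

Lemma basisP l : exists b,
  [/\ {subset b <= l}, lin_indep b, forall x, x \in l -> in_span b x & size b = sdim l].
Proof.
have [b bl []] := lin_indep_extend l lin_indep_nil.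
rewrite cats0 => ind sub; exists b; split=> //; first exact: mem_subseq.
apply/eqP; rewrite eqn_leq; apply/andP; split; last first.
  apply/bigmax_leqP => m /asboolP indm; apply: lin_indep_leq indm _ => x /mem_mask.
  exact: sub.
have [m sz bE] := subseqP bl.
have szm : size m == size l by rewrite sz.
rewrite bE in ind *; rewrite /sdim.
exact: (@leq_bigmax_cond _ _ (fun m : (size l).-tuple bool => size (mask m l))
  (Tuple szm) (asboolT ind)).
Qed.

Lemma sdim_leq l l' : (forall x, x \in l -> in_span l' x) -> (sdim l <= sdim l')%N.
Proof.
move=> sub; have [b [bl ind _ <-]] := basisP l; have [b' [_ _ bl' <-]] := basisP l'.
by apply: lin_indep_leq ind _ => x /bl/sub; apply: in_span_trans.
Qed.

Lemma sdim_subset l l' : {subset l <= l'} -> (sdim l <= sdim l')%N.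
Proof. by move=> sub; apply: sdim_leq => x /sub/in_span_mem. Qed.

Lemma sdim_size l : (sdim l <= size l)%N.
Proof.
have [b [bl ind _ <-]] := basisP l.
by apply: lin_indep_leq ind _ => x /bl/in_span_mem.
Qed.

Lemma sdim_indep l : lin_indep l -> sdim l = size l.
Proof.
move=> ind; apply/eqP; rewrite eqn_leq sdim_size /=.
by have [b [_ _ + <-]] := basisP l; apply: lin_indep_leq.
Qed.

Lemma sdim_cat l l' : (sdim (l ++ l') <= sdim l + sdim l')%N.
Proof.
have [b [_ _ bl <-]] := basisP l; have [b' [_ _ bl' <-]] := basisP l'.
rewrite -size_cat; apply: leq_trans (sdim_size _); apply: sdim_leq => x.
by rewrite mem_cat => /orP[/bl|/bl'];
  apply: in_span_subset => y yb; rewrite mem_cat yb ?orbT.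
Qed.

Lemma sdim_gt0 l : (0 < sdim l)%N <-> exists2 x, x \in l & x <> 0.
Proof.
split=> [|[x xl x0]].
  have [[|x b] [bl ind _ <-]] := basisP l => // _.
  exists x; first exact/bl/mem_head.
  by move=> x0; have [_] := (lin_indep_cons x b).1 ind; rewrite x0; case; exact: in_span0.
have <- : sdim [:: x] = 1%N.
  by apply: sdim_indep; apply/lin_indep_cons; split; [exact: lin_indep_nil|move=> /in_span_nil].
by apply: sdim_subset => y; rewrite inE => /eqP->.
Qed.

(** [d] spans a complement of the smaller span, so its size is a codimension. *)
Lemma sdim_extend l l' : (forall x, x \in l' -> in_span l x) -> exists2 d,
  (size d + sdim l' = sdim l)%N & forall x, x \in l -> in_span (d ++ l') x.
Proof.
move=> sub; have [b [bl' ind spanb <-]] := basisP l'.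
have [d dl [indd spand]] := lin_indep_extend l ind.
exists d.
  rewrite -size_cat -(sdim_indep indd); apply/eqP; rewrite eqn_leq.
  rewrite (sdim_leq spand) andbT; apply: sdim_leq => x; rewrite mem_cat => /orP[xd|/bl'/sub//].
  exact/in_span_mem/(mem_subseq dl).
move=> x /spand; apply: in_span_subset => y.
by rewrite !mem_cat => /orP[->//|/bl'->]; rewrite orbT.
Qed.

(** * Rank and nullity of a linear map on a span *)

Section Map.
Variables (f : A -> A) (fL : linear f).

Lemma sdim_map_le l : (sdim (map f l) <= sdim l)%N.
Proof.
have [b [_ _ bl <-]] := basisP l; rewrite -(size_map f b).
apply: leq_trans (sdim_size _); apply: sdim_leq => x /mapP[y /bl yb ->].
exact: in_span_map.
Qed.

Lemma basis_map l : exists b, [/\ {subset b <= l}, lin_indep (map f b),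
  forall x, x \in l -> in_span (map f b) (f x) & size b = sdim (map f l)].
Proof.
have [b' [bl ind sub sz]] := basisP (map f l).
have [b [bE bsub]] : exists b, b' = map f b /\ {subset b <= l}.
  elim: b' bl {ind sub sz} => [|y b' IH] bl; first by exists [::].
  have /mapP[x xl yE] := bl y (mem_head _ _).
  have [|b [-> bl2]] := IH; first by move=> t tb; apply: bl; rewrite inE tb orbT.
  by exists (x :: b); split; [rewrite yE|move=> t; rewrite inE => /predU1P[->|/bl2]].
exists b; split=> //; first by rewrite -bE.
  by move=> x xl; rewrite -bE; apply/sub/map_f.
by rewrite -sz bE size_map.
Qed.

(** A lifted basis of the image is independent modulo the kernel. Here [l0] is any part of the
    kernel: inside a product V W, only V times a kernel will be at hand. *)
Lemma sdim_kernel_le l l0 : (forall x, x \in l0 -> in_span l x /\ f x = 0) ->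
  (sdim (map f l) + sdim l0 <= sdim l)%N.
Proof.
move=> sub; have [b [bl indb _ <-]] := basis_map l.
have [b0 [bl0 ind0 _ <-]] := basisP l0.
have f0 : f 0 = 0 by have := fL (-1) 0 0; rewrite scaler0 addr0 scaleN1r addNr.
have spanf x : in_span b0 x -> f x = 0.
  apply: (@in_span_closed (fun x => f x = 0)) => // [y z fy fz|a y fy|y /bl0/sub[]//].
    by have := fL 1 y z; rewrite !scale1r => ->; rewrite fy fz addr0.
  by have := fL a y 0; rewrite !addr0 fy f0 scaler0 addr0.
suff ind : lin_indep (b ++ b0).
  rewrite -size_cat -(sdim_indep ind).
  by apply: sdim_leq => x; rewrite mem_cat => /orP[/bl/in_span_mem//|/bl0/sub[]].
elim: b indb {bl} => [//|y b IH] /lin_indep_cons[/IH ind nfy].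
apply/lin_indep_cons; split=> // yb; apply: nfy.
have := in_span_map fL yb; apply: in_span_trans => _ /mapP[z + ->].
rewrite mem_cat => /orP[zb|/in_span_mem/spanf->]; last exact: in_span0.
exact/in_span_mem/map_f.
Qed.

Lemma sdim_kernel l : exists2 l0, (forall x, x \in l0 -> in_span l x /\ f x = 0) &
  (sdim l <= sdim (map f l) + sdim l0)%N.
Proof.
have [b [bl indb spanb <-]] := basis_map l.
have fD x y : f (x + y) = f x + f y by have := fL 1 x y; rewrite !scale1r.
have f0 : f 0 = 0 by have := fL (-1) 0 0; rewrite scaler0 addr0 scaleN1r addNr.
have fZ a x : f (a *: x) = a *: f x by have := fL a x 0; rewrite !addr0 f0 addr0.
have lift y : in_span (map f b) y -> exists2 t, in_span b t & f t = y.
  elim: b {bl indb spanb} y => [|z b IH] y.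
    by move=> /in_span_nil->; exists 0 => //; exact: in_span0.
  move=> /in_span_cons[a [u [/IH[t bt <-] ->]]].
  exists (a *: z + t); last by rewrite fL.
  by apply/in_span_cons; exists a, t.
have /choice[t tP] x : exists t, x \in l -> in_span b t /\ f t = f x.
  case: (boolP (x \in l)) => [/spanb/lift[t bt ft]|_]; last by exists 0.
  by exists t.
(* Subtracting from [x] the combination of [b] with the same image lands in the kernel, and these
   differences together with [b] span [l]. *)
exists [seq x - t x | x <- l].
  move=> _ /mapP[x xl ->]; have [bt ft] := tP x xl; split.
    apply: in_spanB; first exact: in_span_mem.
    exact: in_span_subset bt.
  by rewrite fD -scaleN1r fZ ft scaleN1r subrr.
set l0 := map _ _.
have le : (sdim b + sdim l0 <= size b + sdim l0)%N by rewrite leq_add2r sdim_size.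
apply: leq_trans (leq_trans (sdim_cat b l0) le).
apply: sdim_leq => x xl; rewrite -(subrK (t x) x); apply: in_spanD.
  by apply: in_span_mem; rewrite mem_cat (map_f (fun x => x - t x)) ?orbT.
have [bt _] := tP x xl; apply: in_span_subset bt => z zb.
by rewrite mem_cat zb.
Qed.

Lemma sdim_map_inj l : (forall x, in_span l x -> f x = 0 -> x = 0) ->
  sdim (map f l) = sdim l.
Proof.
move=> inj; apply/eqP; rewrite eqn_leq sdim_map_le /=.
have [l0 l0P le] := sdim_kernel l.
suff l00 : sdim l0 = 0%N by rewrite l00 addn0 in le.
apply/eqP; rewrite -leqn0 leqNgt; apply/negP => /sdim_gt0[x /l0P[lx fx] []].
exact: inj.
Qed.

End Map.

Lemma vmul_span v w x y : in_span v x -> in_span w y -> in_span (vmul v w) (x * y).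
Proof.
move=> vx wy.
apply: (@in_span_closed (fun x => in_span (vmul v w) (x * y))) vx.
- by rewrite mul0r; exact: in_span0.
- by move=> a b ? ?; rewrite mulrDl; exact: in_spanD.
- by move=> a b ?; rewrite -scalerAl; exact: in_spanZ.
move=> {}x vx; apply: (@in_span_closed (fun y => in_span (vmul v w) (x * y))) wy.
- by rewrite mulr0; exact: in_span0.
- by move=> a b ? ?; rewrite mulrDr; exact: in_spanD.
- by move=> a b ?; rewrite -scalerAr; exact: in_spanZ.
by move=> {}y wy; apply/in_span_mem/allpairs_f.
Qed.

End Dimension.

(** * Annihilators and independent sequences in right modules *)

(** Dependent choice in which a new term may depend on all earlier ones; [C] is an invariant of the
    finite prefixes that guarantees a next term. *)
Lemma greedy_sequence (T : Type) (C : seq T -> Prop) (P : seq T -> T -> Prop) :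
  C [::] -> (forall l x, C l -> P l x -> C (rcons l x)) ->
  (forall l, C l -> exists x, P l x) ->
  exists f : nat -> T, forall n, P (mkseq f n) (f n).
Proof.
move=> C0 CS ex; have [x0 _] := ex _ C0.
have /choice[next nextP] l : exists x, C l -> P l x.
  by case: (pselect (C l)) => [/ex[x Px]|nC]; [exists x|exists x0].
pose F n := iter n (fun l => rcons l (next l)) [::].
have FE n : F n = mkseq (next \o F) n by elim: n => // n IH; rewrite mkseqS -IH.
have CF n : C (F n) by elim: n => //= n IH; apply/CS/nextP.
by exists (next \o F) => n; rewrite -FE /=; exact: nextP.
Qed.

(* The induction is on the support of [c], in the left module [N] of the vectors [c : G -> L] with [sum_g c_g g(y) = 0] on [L]: for [x] with [g0(x) = r c_g0], the vector [c_g0 r c - (c_g g(x))_g] is in [N] and vanishes at [g0]. *)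
Lemma traceless_left_ideal (R : nzRingType) (gT : finGroupType)
    (act : gT -> R -> R) (L : R -> Prop) :
  (forall a b : R, (forall r, a * r * b = 0) -> a = 0 \/ b = 0) ->
  (forall x : R, x *+ #|gT| = 0 -> x = 0) ->
  (forall g x y, act g (x * y) = act g x * act g y) ->
  (forall x, act 1%g x = x) -> (forall g h x, act (g * h)%g x = act g (act h x)) ->
  (forall x y, L x -> L y -> L (x - y)) -> (forall r x, L x -> L (r * x)) ->
  (forall g x, L x -> L (act g x)) ->
  (forall x, L x -> \sum_g act g x = 0) -> forall x, L x -> x = 0.
Proof.
move=> prime tors actM act1 actMg LB LM Lact tr0.
suff N0 (n : nat) (c : gT -> R) : (#|[pred g | c g != 0%R]| <= n)%N -> (forall g, L (c g)) ->
    (forall y, L y -> \sum_g c g * act g y = 0) -> \sum_g c g = 0.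
  (* The constant vector [x] lies in [N] because [L] is traceless, and its sum is [x] taken [#|gT|]
     times. *)
  move=> x Lx; apply: tors; rewrite -sumr_const; apply: (N0 #|gT| (fun=> x)) => //.
    exact: max_card.
  by move=> y Ly; rewrite -mulr_sumr tr0 ?mulr0.
elim: n c => [|n IH] c supp Lc c0; have [g0 cg0|] := pickP [pred g | c g != 0];
  try by move=> c00; rewrite big1 // => g _; have /negbFE/eqP := c00 g.
  by move: supp; rewrite (cardD1 g0) inE -[c g0 != 0]/([pred g | c g != 0] g0) cg0.
suff /prime[cg00|//] : forall r, c g0 * r * \sum_g c g = 0.
  by case/negP: cg0; rewrite cg00.
move=> r; pose x := act g0^-1%g (r * c g0); have Lx : L x by apply/Lact/LM.
(* As [x] lies in [L], the subtracted terms sum to zero; the induction hypothesis thus kills the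
   right-hand side for every [r], and primeness cancels [c g0]. *)
have <- : \sum_g (c g0 * r * c g - c g * act g x) = c g0 * r * \sum_g c g.
  by rewrite big_split /= sumrN c0 // subr0 mulr_sumr.
apply: IH => [|g|y Ly].
- rewrite -ltnS; apply: leq_trans supp; apply: proper_card.
  apply/properP; split; last first.
    by exists g0 => //; rewrite inE /x -actMg mulgV act1 mulrA subrr eqxx.
  apply/fintype.subsetP => g; rewrite !inE; apply: contraNneq => ->.
  by rewrite mulr0 mul0r subrr.
- apply: (LB); first exact: LM.
  exact/LM/Lact.
- under eq_bigr => g _ do rewrite mulrBl -!mulrA -actM.
  rewrite big_split /= sumrN c0 ?subr0; last exact: LM.
  by rewrite -mulr_sumr -mulr_sumr c0 // !mulr0.
Qed.

Lemma big_nat_shift (V : zmodType) N n (F : nat -> V) :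
  \sum_(N <= i < n + N) F i = \sum_(0 <= j < n) F (j + N)%N.
Proof. by rewrite -{1}[N]add0n big_addn addnK. Qed.

Section RightModules.
Variables (k : fieldType) (A : algType k) (S : A -> Prop) (subS : subalg S).

Let S1 : S 1. Proof. by case: subS. Qed.
Let SD x y : S x -> S y -> S (x + y). Proof. by case: subS => _ + _ _; apply. Qed.
Let SM x y : S x -> S y -> S (x * y). Proof. by case: subS => _ _ + _; apply. Qed.
Let S0 : S 0. Proof. by case: subS => _ _ _ /(_ 0 1 S1); rewrite scale0r. Qed.

Lemma rann1 x r : rann S (eq x) r <-> S r /\ x * r = 0.
Proof. by split=> [[Sr /(_ _ erefl)]|[Sr xr]]; split=> // _ <-. Qed.

(** Without such an [x], dependent choice gives elements of [P] whose right annihilators increase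
    strictly; the chain condition is applied to the singletons [eq (f n)]. *)
Lemma acc_rann_max (P : A -> Prop) : acc_rann S -> (forall x, P x -> S x) ->
  (exists x, P x) -> exists2 x, P x & forall y, P y ->
    (forall r, S r -> x * r = 0 -> y * r = 0) -> forall r, S r -> y * r = 0 -> x * r = 0.
Proof.
move=> acc PS [x0 Px0]; apply: contrapT => nmax.
have /choice[next nextP] x : exists y, P x -> [/\ P y,
    forall r, S r -> x * r = 0 -> y * r = 0 & exists r, [/\ S r, y * r = 0 & x * r <> 0]].
  case: (pselect (P x)) => [Px|]; last by exists x.
  apply: contrapT => nex; apply: nmax; exists x => // y Py xy r Sr yr.
  by apply: contrapT => xr; apply: nex; exists y => _; split=> //; exists r.
pose f n := iter n next x0.
have Pf n : P (f n) by elim: n => //= n /nextP[].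
have [n x||N fN] := acc (fun n => eq (f n)).
- by move=> <-; exact/PS/Pf.
- move=> n r /rann1[Sr fr]; apply/rann1; split=> //.
  by have [_ + _] := nextP _ (Pf n); apply.
have [_ _ [r [Sr yr xr]]] := nextP _ (Pf N).
by have /(_ r)[/(_ (proj2 (rann1 _ _) (conj Sr yr)))/rann1[_ ]] := fN N.+1 (leqnSn N).
Qed.

Lemma exprS_mem x n : S x -> S (x ^+ n).
Proof. by move=> Sx; elim: n => [|n IH]; rewrite ?expr0 // exprS; exact: SM. Qed.

(* Otherwise [S b] is nil; for [c] in [S b] with maximal annihilator, [t c] is killed by a power of itself with the same annihilator as [c], so [c t c = 0]. *)
Lemma exists_nonnilpotent b : prime_ring S -> acc_rann S -> S b -> b <> 0 ->
  exists2 t, S t & forall n, (b * t) ^+ n <> 0.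
Proof.
move=> prime acc Sb b0; apply: contrapT => nil.
have nilb t : S t -> exists n, (t * b) ^+ n = 0.
  move=> St; apply: contrapT => tb; apply: nil; exists t => // n bt.
  apply: tb; exists n.+1; rewrite exprSr.
  suff -> : (t * b) ^+ n * (t * b) = t * (b * t) ^+ n * b by rewrite bt mulr0 mul0r.
  elim: n {bt} => [|n IH]; first by rewrite !expr0 mul1r mulr1.
  by rewrite exprS -mulrA IH exprS !mulrA.
pose P c := [/\ S c, c <> 0 & exists2 s, S s & c = s * b].
have [c||c [Sc c0 [s Ss cE]] cmax] := @acc_rann_max P acc; first by case.
  by exists b; split=> //; exists 1; rewrite ?mul1r.
have ctc t : S t -> c * t * c = 0.
  move=> St; have Stc : S (t * c) by exact: SM.
  have [|n0 n0P] := nilb (t * s); first exact: SM.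
  rewrite -mulrA -cE in n0P.
  have [[|[|n]] nP nmin] := ex_minnP (ex_intro (fun n => (t * c) ^+ n == 0) n0 (introT eqP n0P)).
  - by move: nP; rewrite expr0 oner_eq0.
  - by move: nP; rewrite expr1 -mulrA => /eqP->; rewrite mulr0.
  rewrite -mulrA; apply: (cmax ((t * c) ^+ n.+1)) => //; last first.
    by rewrite -exprSr; apply/eqP.
    move=> r Sr cr; rewrite exprSr -!mulrA cr !mulr0 //.
  split; first exact: exprS_mem.
    by move=> /eqP/nmin; rewrite ltnn.
  exists ((t * c) ^+ n * (t * s)); first by apply: SM; [exact: exprS_mem|exact: SM].
  by rewrite exprSr cE !mulrA.
by have [] := prime c c Sc Sc ctc.
Qed.

Lemma fin_rudim_sequence (u : nat -> A) : fin_rudim S ->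
  (forall n, S (u n) /\ u n <> 0) ->
  ~ forall n (r : nat -> A), (forall i, S (r i)) ->
      \sum_(i < n) u i * r i = 0 -> forall i, (i < n)%N -> u i * r i = 0.
Proof.
move=> fin uP ind; apply: fin.
exists (fun n x => exists2 r, S r & x = u n * r); split=> [n|n x xP x0].
  have [Su u0] := uP n; split; last by exists (u n); split=> //; exists 1; rewrite ?mulr1.
  split.
  - by move=> _ [r Sr ->]; exact: SM.
  - by exists 0; rewrite ?mulr0.
  - by move=> _ _ [r Sr ->] [t St ->]; exists (r + t); [exact: SD|rewrite mulrDr].
  - by move=> _ t [r Sr ->] St; exists (r * t); [exact: SM|rewrite mulrA].
have /choice[r rP] i : exists r, S r /\ ((i < n)%N -> x i = u i * r).
  by case: (ltnP i n) => [/xP[r Sr ->]|_]; [exists r|exists 0].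
move=> i lt; rewrite (rP i).2 //; apply: ind (lt) => [j|]; first by have [] := rP j.
by rewrite -[RHS]x0; apply: eq_bigr => j _; rewrite (rP j).2.
Qed.

Variables (M : zmodType) (mr : M -> A -> M).
Hypotheses (mrDl : forall x y r, mr (x + y) r = mr x r + mr y r)
  (mrDr : forall x r s, mr x (r + s) = mr x r + mr x s)
  (mrA : forall x r s, mr (mr x r) s = mr x (r * s)) (mr1 : forall x, mr x 1 = x).

Let mr0 x : mr x 0 = 0.
Proof. by apply: (addrI (mr x 0)); rewrite -mrDr !addr0. Qed.
Let mr0l r : mr 0 r = 0.
Proof. by apply: (addrI (mr 0 r)); rewrite -mrDl !addr0. Qed.
Let mr_suml n m (F : nat -> M) r :
  mr (\sum_(n <= i < m) F i) r = \sum_(n <= i < m) mr (F i) r.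
Proof. exact: (big_morph (mr^~ r) (fun x y => mrDl x y r) (mr0l r)). Qed.

(** Independence of the cyclic submodules generated by the [y i]: a vanishing sum kills its terms,
    whereas nonzero coefficients may survive through torsion. *)
Definition indep_sequence (y : nat -> M) : Prop :=
  (forall i, y i <> 0) /\ forall n (r : nat -> A), (forall i, S (r i)) ->
    \sum_(0 <= i < n) mr (y i) (r i) = 0 -> forall i, (i < n)%N -> mr (y i) (r i) = 0.

(** On every tail of [y] some nonzero combination is killed by [f]: otherwise [f] is injective on
    the combinations of that tail, and the images generate an infinite independent family of right
    ideals of [S]. Combinations on disjoint blocks are again independent. [Q] carries along the
    kernels of maps treated before. *)
Lemma indep_sequence_kernel (y : nat -> M) (f : M -> A) (Q : M -> Prop) :
  fin_rudim S -> indep_sequence y ->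
  (forall x, S (f x)) -> (forall x z, f (x + z) = f x + f z) ->
  (forall x r, S r -> f (mr x r) = f x * r) ->
  Q 0 -> (forall x z, Q x -> Q z -> Q (x + z)) -> (forall x r, S r -> Q x -> Q (mr x r)) ->
  (forall i, Q (y i)) ->
  exists z, indep_sequence z /\ forall i, Q (z i) /\ f (z i) = 0.
Proof.
move=> fin [y0 yind] Sf fD fM Q0 QD QM Qy.
have f0 : f 0 = 0 by apply: (addrI (f 0)); rewrite -fD !addr0.
have f_sum n m (F : nat -> M) : f (\sum_(n <= i < m) F i) = \sum_(n <= i < m) f (F i).
  exact: (big_morph f fD f0).
have shift N n r : \sum_(0 <= j < n) mr (y (j + N)%N) (r j) =
    \sum_(0 <= i < n + N) mr (y i) (if (N <= i)%N then r (i - N)%N else 0).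
  rewrite [RHS](big_cat_nat (n := N)) ?leq_addl //= [X in _ = X + _]big1_seq ?add0r.
    rewrite big_nat_shift; apply: eq_bigr => j _.
    by rewrite leq_addl addnK.
  by move=> i /andP[_]; rewrite mem_index_iota => /andP[_ lt]; rewrite leqNgt lt mr0.
pose comb N p := \sum_(0 <= j < p.1) mr (y (j + N)%N) (p.2 j).
have /choice[p pP] N : exists p : nat * (nat -> A), [/\
    forall i, S (p.2 i), comb N p <> 0 & f (comb N p) = 0].
  apply: contrapT => nex.
  have inj m r : (forall i, S (r i)) -> \sum_(0 <= j < m) f (y (j + N)%N) * r j = 0 ->
      \sum_(0 <= j < m) mr (y (j + N)%N) (r j) = 0.
    move=> Sr r0; apply: contrapT => nz; apply: nex; exists (m, r); split=> //.
    by rewrite f_sum -[RHS]r0; apply: eq_bigr => i _; rewrite fM.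
  apply: (fin_rudim_sequence (u := fun j => f (y (j + N)%N)) fin) => [j|n r Sr r0 j lt].
    split=> // fy; apply: (y0 (j + N)%N); rewrite -[LHS]mr1.
    have := inj j.+1 (fun i => if i == j then 1 else 0).
    have zeros (V : zmodType) (F : nat -> V) : (forall i, (i < j)%N -> F i = 0) ->
        \sum_(0 <= i < j) F i = 0.
      by move=> F0; rewrite big_nat big1 // => i /andP[_ /F0].
    rewrite !big_nat_recr //= eqxx fy mul0r addr0 !zeros ?add0r => [|i lt|i lt].
    - by apply=> // i; case: ifP.
    - by rewrite (ltn_eqF lt) mr0.
    - by rewrite (ltn_eqF lt) mulr0.
  have : \sum_(0 <= j < n) mr (y (j + N)%N) (r j) = 0 by apply: inj; rewrite // big_mkord.
  rewrite shift => /yind/(_ (j + N)%N); rewrite ltn_add2r leq_addl addnK -fM // => ->//.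
  by move=> i; case: ifP.
(* [B n] is where the block of [z n] starts: the total length of the earlier blocks, so that blocks
   never overlap. *)
pose B := fix B n := if n is m.+1 then ((p (B m)).1 + B m)%N else 0%N.
pose z n := comb (B n) (p (B n)).
have Sp n i : S ((p n).2 i) by have [] := pP n.
exists z; split; last first.
  move=> n; split; last by have [] := pP (B n).
  by apply: big_ind => // i _; exact: QM.
split=> [n|n s Ss s0 m lt]; first by have [] := pP (B n).
(* [rho] concatenates the coefficients of the blocks, each multiplied by its [s m]; independence of
   [y] then kills every term of every block. *)
have [rho [Srho sE rhoE]] : exists rho, [/\ forall i, S (rho i),
    \sum_(0 <= i < n) mr (z i) (s i) = \sum_(0 <= i < B n) mr (y i) (rho i) &
    forall m, (m < n)%N -> forall j, (j < (p (B m)).1)%N ->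
      rho (j + B m)%N = (p (B m)).2 j * s m /\ (j + B m < B n)%N].
  elim: n {s0 m lt} => [|n [rho [Srho sE rhoE]]].
    by exists (fun=> 0); split=> //; rewrite !big_nil.
  exists (fun i => if (i < B n)%N then rho i else (p (B n)).2 (i - B n)%N * s n).
  split=> [i||i]; first by case: ifP => // _; exact: SM.
    rewrite big_nat_recr //= sE [RHS](big_cat_nat (n := B n)) ?leq_addl //=; congr (_ + _).
      by rewrite !big_nat; apply: eq_bigr => i /andP[_ ->].
    rewrite big_nat_shift mr_suml; apply: eq_bigr => j _.
    by rewrite ltnNge leq_addl addnK mrA.
  rewrite ltnS leq_eqVlt => /predU1P[->|lt] j jlt.
    by rewrite ltnNge leq_addl addnK /= ltn_add2r.
  have [rE blt] := rhoE i lt j jlt; rewrite blt; split=> //.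
  exact: leq_trans blt (leq_addl _ _).
rewrite mr_suml big_nat big1 // => j /andP[_ jlt].
have [rE blt] := rhoE m lt j jlt; rewrite mrA -rE.
by apply: yind blt => //; rewrite -sE.
Qed.

(** Applying [f i] to a vanishing sum whose terms before [i] are already zero leaves the term [i]
    alone, and [f i] is injective there. *)
Lemma indep_sequence_triangular (y : nat -> M) (f : nat -> M -> A) :
  (forall i x z, f i (x + z) = f i x + f i z) ->
  (forall i, y i <> 0) ->
  (forall i j r, S r -> (i < j)%N -> f i (mr (y j) r) = 0) ->
  (forall i r, S r -> f i (mr (y i) r) = 0 -> mr (y i) r = 0) ->
  indep_sequence y.
Proof.
move=> fD y0 fgt feq; split=> // n r Sr r0 i.
have f0 j : f j 0 = 0 by apply: (addrI (f j 0)); rewrite -fD !addr0.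
elim/ltn_ind: i => i IH lt; apply: feq => //.
have := congr1 (f i) r0; rewrite f0 (big_morph (f i) (fD i) (f0 i)).
rewrite (big_cat_nat (n := i)) ?(ltnW lt) //= big_nat big1 ?add0r.
  rewrite big_ltn // big_nat big1 ?addr0 // => j /andP[ij _]; exact: fgt.
by move=> j /andP[_ ji]; rewrite IH // (ltn_trans ji).
Qed.

(** The maps are killed one at a time, each time keeping a whole independent sequence and not just
    one element. *)
Lemma indep_sequence_common_kernel (I : eqType) (fs : seq I) (f : I -> M -> A) y :
  fin_rudim S -> indep_sequence y ->
  (forall i x, S (f i x)) -> (forall i x z, f i (x + z) = f i x + f i z) ->
  (forall i x r, S r -> f i (mr x r) = f i x * r) ->
  exists2 z, z <> 0 & forall i, i \in fs -> f i z = 0.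
Proof.
move=> fin yind Sf fD fM.
suff [z [[z0 _] fz]] : exists z, indep_sequence z /\
    forall n i, i \in fs -> f i (z n) = 0 by exists (z 0%N) => [|i]; [exact: z0|exact: fz].
elim: fs => [|i fs [z [zind fz]]]; first by exists y.
pose Q x := forall j, j \in fs -> f j x = 0.
have f0 j : f j 0 = 0 by apply: (addrI (f j 0)); rewrite -fD !addr0.
have [|x t Qx Qt j js|x r Sr Qx j js||t [tind tP]] :=
  @indep_sequence_kernel z (f i) Q fin zind (Sf i) (fD i) (fM i).
- by move=> j _; rewrite f0.
- by rewrite fD Qx // Qt // addr0.
- by rewrite fM // Qx // mul0r.
- by [].
- exists t; split=> // n j; have [Qt ft] := tP n.
  by rewrite inE => /predU1P[->|/Qt].
Qed.

End RightModules.

(** * The trace form *)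

Lemma whole_subalg (k : fieldType) (A : algType k) : subalg (whole A).
Proof. by []. Qed.

Section FixedRing.
Variables (k : fieldType) (A : algType k) (gT : finGroupType) (act : gT -> A -> A).
Hypotheses (actP : faithful_alg_action act) (char0 : [pchar k] =i pred0).
Local Notation B := (fixed_ring act).
Local Notation tr := (trace act).

Lemma act_linear g : linear (act g).
Proof.
have [/(_ g)[aB [aZ _]] _ _ _] := actP.
have a0 : act g 0 = 0 by rewrite -[0 in LHS](subrr 0) aB subrr.
have aN x : act g (- x) = - act g x by rewrite -[- x]sub0r aB a0 sub0r.
by move=> a x y; rewrite -{1}(opprK y) aB aN opprK aZ.
Qed.

Lemma act_mul g x y : act g (x * y) = act g x * act g y.
Proof. by have [/(_ g)[_ [_ []]]] := actP. Qed.

Lemma act_one g : act g 1 = 1.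
Proof. by have [/(_ g)[_ [_ []]]] := actP. Qed.

Lemma act_id x : act 1%g x = x.
Proof. by have [] := actP. Qed.

Lemma act_comp g h x : act (g * h)%g x = act g (act h x).
Proof. by have [] := actP. Qed.

Lemma act_add g x y : act g (x + y) = act g x + act g y.
Proof. by have := act_linear g 1 x y; rewrite !scale1r. Qed.

Lemma act_zero g : act g 0 = 0.
Proof. by apply: (addrI (act g 0)); rewrite -act_add !addr0. Qed.

Lemma fixed_subalg : subalg B.
Proof.
split=> [g|x y Bx By g|x y Bx By g|c x Bx g]; first exact: act_one.
- by rewrite act_add Bx By.
- by rewrite act_mul Bx By.
- by rewrite -[c *: x]addr0 act_linear Bx act_zero.
Qed.

Lemma trace_linear : linear tr.
Proof.
move=> a x y; rewrite /trace scaler_sumr -big_split /=.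
by apply: eq_bigr => g _; rewrite act_linear.
Qed.

Lemma trace_add x y : tr (x + y) = tr x + tr y.
Proof. by have := trace_linear 1 x y; rewrite !scale1r. Qed.

Lemma trace_sub x y : tr (x - y) = tr x - tr y.
Proof. by have := trace_linear (-1) y x; rewrite !scaleN1r ![- _ + _]addrC. Qed.

Lemma trace_fixed x : B (tr x).
Proof.
move=> h; rewrite /trace (big_morph (act h) (act_add h) (act_zero h)).
rewrite [RHS](reindex_inj (mulgI h)); apply: eq_bigr => g _.
by rewrite act_comp.
Qed.

Lemma trace_mulr x b : B b -> tr (x * b) = tr x * b.
Proof.
by move=> Bb; rewrite /trace mulr_suml; apply: eq_bigr => g _; rewrite act_mul Bb.
Qed.

Lemma trace_mull x b : B b -> tr (b * x) = b * tr x.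
Proof.
by move=> Bb; rewrite /trace mulr_sumr; apply: eq_bigr => g _; rewrite act_mul Bb.
Qed.

Lemma trace_act g x : tr (act g x) = tr x.
Proof.
rewrite /trace [RHS](reindex_inj (mulIg g)).
by apply: eq_bigr => h _; rewrite act_comp.
Qed.

Hypothesis primeA : prime_ring (whole A).

Let torsion_free (x : A) : x *+ #|gT| = 0 -> x = 0.
Proof.
rewrite -scaler_nat => /eqP; rewrite scaler_eq0 => /orP[|/eqP//].
rewrite ((pcharf0P k).1 char0) => /eqP/card0_eq/(_ 1%g);
by rewrite inE.
Qed.

(** The elements in question form a left ideal, stable under the group because the trace is
    invariant, and traceless by the case [x = 1]. *)
Lemma trace_nondegenerate_left a : (forall x, tr (x * a) = 0) -> a = 0.
Proof.
apply: (@traceless_left_ideal A gT act (fun a => forall x, tr (x * a) = 0)) => {a}.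
- by move=> a b ab; apply: primeA => // r _.
- exact: torsion_free.
- exact: act_mul.
- exact: act_id.
- exact: act_comp.
- by move=> a b ta tb x; rewrite mulrBr trace_sub ta tb subrr.
- by move=> r a ta x; rewrite mulrA.
- by move=> g a ta x; rewrite -(trace_act g^-1%g) act_mul -act_comp mulVg act_id.
- by move=> a /(_ 1); rewrite mul1r.
Qed.

(** The same argument in the opposite ring [A^c], where right ideals become left ideals. *)
Lemma trace_nondegenerate_right a : (forall x, tr (a * x) = 0) -> a = 0.
Proof.
move: a; refine (@traceless_left_ideal A^c gT act
  (fun a : A => forall x : A, tr (a * x) = 0) _ _ _ _ _ _ _ _ _).
- by move=> a b ab; apply/or_comm/primeA => // r _; rewrite -mulrA; exact: ab.
- exact: torsion_free.
- by move=> g x y; exact: act_mul.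
- exact: act_id.
- exact: act_comp.
- by move=> a b ta tb x; rewrite mulrBl trace_sub ta tb subrr.
- by move=> r a ta x; rewrite -mulrA.
- by move=> g a ta x; rewrite -(trace_act g^-1%g) act_mul -act_comp mulVg act_id.
- by move=> a /(_ 1); rewrite mulr1.
Qed.

End FixedRing.

(** Some multiple [b * t] is not nilpotent; the annihilators in [T] of its powers stabilise at some
    [N], and its power [N.+1] is still a multiple of [b]. [T] may exceed [S], as when an element of
    [B] has to be cancelled in front of coefficients from [A]. *)
Lemma exists_stable_multiple (k : fieldType) (A : algType k) (S T : A -> Prop) b :
  subalg S -> set_sub S T -> prime_ring S -> acc_rann S -> acc_rann T -> S b -> b <> 0 ->
  exists t, [/\ S t, b * t <> 0 & forall r, T r -> b * t * (b * t * r) = 0 -> b * t * r = 0].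
Proof.
move=> subS ST primeS accS accT Sb b0.
have [t St nil] := exists_nonnilpotent subS primeS accS Sb b0.
have Sbt : S (b * t) by case: subS => _ _ SM _; exact: SM.
have Sexp n : S ((b * t) ^+ n) by exact: exprS_mem.
have [n x <-|n r /rann1[Tr xr]|N NP] := accT (fun n => eq ((b * t) ^+ n)).
- exact: ST.
- by apply/rann1; split=> //; rewrite exprS -mulrA xr mulr0.
have E : b * (t * (b * t) ^+ N) = (b * t) ^+ N.+1 by rewrite exprS mulrA.
exists (t * (b * t) ^+ N); rewrite E; split; first by case: subS => _ _ SM _; exact: SM.
  exact: nil.
move=> r Tr r0; have /(_ r)[+ _] := NP (N.+1 + N.+1)%N (leq_trans (leqnSn N) (leq_addr _ _)).
case/(_ _)/rann1; last by move=> _ Nr; rewrite exprS -mulrA Nr mulr0.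
by apply/rann1; split=> //; rewrite exprD -mulrA.
Qed.

(** * Uniform dimension of A over its fixed ring *)

Section FinitenessOverFixedRing.
Variables (k : fieldType) (A : algType k) (gT : finGroupType) (act : gT -> A -> A).
Hypotheses (actP : faithful_alg_action act) (char0 : [pchar k] =i pred0)
  (pgA : prime_goldie (whole A)) (pgB : prime_goldie (fixed_ring act)).
Local Notation B := (fixed_ring act).
Local Notation tr := (trace act).

Let primeA : prime_ring (whole A). Proof. by case: pgA. Qed.
Let accA : acc_rann (whole A). Proof. by case: pgA => _ [[]]. Qed.
Let finA : fin_rudim (whole A). Proof. by case: pgA => _ [[]]. Qed.
Let primeB : prime_ring B. Proof. by case: pgB. Qed.
Let accB : acc_rann B. Proof. by case: pgB => _ [[]]. Qed.
Let finB : fin_rudim B. Proof. by case: pgB => _ [[]]. Qed.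
Let subB : subalg B. Proof. exact: fixed_subalg. Qed.
Let B1 : B 1. Proof. by case: subB. Qed.
Let BD x y : B x -> B y -> B (x + y). Proof. by case: subB => _ + _ _; apply. Qed.
Let BM x y : B x -> B y -> B (x * y). Proof. by case: subB => _ _ + _; apply. Qed.
Let B0 : B 0. Proof. by move=> g; exact: act_zero. Qed.
Let BN x : B x -> B (- x).
Proof. by case: subB => _ _ _ /(_ (-1) x); rewrite scaleN1r. Qed.

(* Otherwise there are [x_i, a_i] with [tr (x_i a_j) = 0] for [i < j] and [b_i = tr (x_i a_i)] nonzero; the vectors [(g(a_i) b_i)_g] are then right independent over [A], against the finite rank of [A^|G|]. *)
Lemma finitely_many_traces_separate :
  exists xs : seq A, forall a, (forall x, x \in xs -> tr (x * a) = 0) -> a = 0.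
Proof.
apply: contrapT => nsep.
pose P (l : seq (A * A)) (p : A * A) := [/\ forall q, q \in l -> tr (q.1 * p.2) = 0,
  tr (p.1 * p.2) <> 0 & forall r : A, tr (p.1 * p.2) * (tr (p.1 * p.2) * r) = 0 ->
    tr (p.1 * p.2) * r = 0].
have [//|//|l _|f fP] := @greedy_sequence (A * A) (fun=> True) P.
  apply: contrapT => nex; apply: nsep; exists (map fst l) => a la.
  apply: contrapT => a0; have [x xa] : exists x, tr (x * a) <> 0.
    apply: contrapT => nx; apply/a0/(trace_nondegenerate_left actP char0 primeA) => x.
    by apply: contrapT => xa; apply: nx; exists x.
  have [|t [Bt bt0 bt]] :=
    exists_stable_multiple subB (T := whole A) _ primeB accB accA (trace_fixed actP _) xa => //.
  (* Multiplying [a] by an element of [B] multiplies every trace by it, so the traces against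
     earlier terms stay zero. *)
  rewrite -(trace_mulr actP) // -mulrA in bt0 bt.
  apply: nex; exists (x, a * t); split=> //= [q ql|r]; last exact: bt.
  by rewrite mulrA (trace_mulr actP) // la ?mul0r ?map_f.
pose M : zmodType := {ffun gT -> A}.
pose mr (y : M) r : M := [ffun g => y g * r].
pose b i := tr ((f i).1 * (f i).2).
(* [phi i] sends the multiple of [y j] by [r] to tr (x_i a_j) b_j r, which is zero for i < j. For i
   = j it is b_i b_i r, which vanishes only if b_i r does: this is what the factor [b i] in [y i] is
   for. *)
pose phi i (y : M) := \sum_g act g (f i).1 * y g.
pose y i : M := [ffun g => act g (f i).2 * b i].
have phiE i j r : phi i (mr (y j) r) = tr ((f i).1 * (f j).2) * (b j * r).
  rewrite /phi /trace mulr_suml; apply: eq_bigr => g _.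
  by rewrite !ffunE act_mul // !mulrA.
have mr1 z : mr z 1 = z by apply/ffunP => g; rewrite ffunE mulr1.
have mrA z r s : mr (mr z r) s = mr z (r * s) by apply/ffunP => g; rewrite !ffunE mulrA.
have mrDl z z' r : mr (z + z') r = mr z r + mr z' r.
  by apply/ffunP => g; rewrite !ffunE mulrDl.
have mrDr z r s : mr z (r + s) = mr z r + mr z s.
  by apply/ffunP => g; rewrite !ffunE mulrDr.
have yind : indep_sequence (whole A) mr y.
  apply: (indep_sequence_triangular (f := phi)) => [i x z|i|i j r _ lt|i r _].
  - by rewrite -big_split; apply: eq_bigr => g _; rewrite ffunE mulrDr.
  - move=> y0; have [_ bi0 /(_ 1)] := fP i; rewrite mulr1 => bb.
    apply/bi0/bb; have := phiE i i 1; rewrite mr1 y0 mulr1 => <-.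
    by rewrite /phi big1 // => g _; rewrite ffunE mulr0.
  - have [/(_ (f i)) + _ _] := fP j.
    by rewrite phiE => ->; [rewrite mul0r|apply: (map_f f); rewrite mem_iota].
  - have [_ _ bb] := fP i; rewrite phiE => /bb br.
    by apply/ffunP => g; rewrite !ffunE -mulrA br mulr0.
have [//|||z z0 zg] := indep_sequence_common_kernel (f := fun g (z : M) => z g)
  (whole_subalg A) mrDl mrDr mrA mr1 (enum gT) finA yind.
- by move=> *; rewrite ffunE.
- by move=> *; rewrite ffunE.
by apply/z0/ffunP => g; rewrite ffunE zg ?mem_enum.
Qed.

Definition fixed_comb (l : seq A) (z : A) : Prop :=
  exists2 b : nat -> A, (forall i, B (b i)) & z = \sum_(0 <= i < size l) l`_i * b i.

Lemma fixed_comb_mulr l z b : B b -> fixed_comb l z -> fixed_comb l (z * b).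
Proof.
move=> Bb [c Bc ->]; exists (fun i => c i * b) => [i|]; first exact: BM.
by rewrite mulr_suml; apply: eq_bigr => i _; rewrite mulrA.
Qed.

Lemma fixed_comb_add l z z' : fixed_comb l z -> fixed_comb l z' -> fixed_comb l (z + z').
Proof.
move=> [c Bc ->] [c' Bc' ->]; exists (fun i => c i + c' i) => [i|]; first exact: BD.
by rewrite -big_split; apply: eq_bigr => i _; rewrite mulrDr.
Qed.

Lemma fixed_comb_cons x l z : fixed_comb l z -> fixed_comb (x :: l) z.
Proof.
move=> [c Bc ->]; exists (fun i => if i is j.+1 then c j else 0) => [[]//|].
by rewrite big_nat_recl //= mulr0 add0r.
Qed.

(** Otherwise elements [f n] can be chosen such that [f n] B meets the sum of the earlier [f i] B
    only in zero; a separating list of traces into B would then have a nonzero common zero. *)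
Lemma essential_finite_submodule : exists l : seq A, forall a, a <> 0 ->
  exists r, [/\ B r, a * r <> 0 & fixed_comb l (a * r)].
Proof.
have [xs sep] := finitely_many_traces_separate.
apply: contrapT => ness.
pose P l a := a <> 0 /\ forall r, B r -> fixed_comb l (a * r) -> a * r = 0.
have [//|//|l _|f fP] := @greedy_sequence A (fun=> True) P.
  apply: contrapT => nex; apply: ness; exists l => a a0.
  apply: contrapT => nr; apply: nex; exists a; split=> // r Br lr.
  by apply: contrapT => ar; apply: nr; exists r.
have yind : indep_sequence B *%R f.
  split=> [i|n r Br]; first by have [] := fP i.
  elim: n => // n IH; rewrite big_nat_recr //= => r0 i.
  have fr : f n * r n = 0.
    have [_] := fP n; apply=> //; exists (fun i => - r i) => [j|]; first exact: BN.
    rewrite size_mkseq; move/eqP: r0; rewrite addrC addr_eq0 => /eqP->.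
    rewrite -sumrN !big_nat; apply: eq_bigr => j /andP[_ lt].
    by rewrite nth_mkseq // mulrN.
  rewrite fr addr0 in r0; rewrite ltnS leq_eqVlt => /predU1P[->//|].
  exact: IH.
have [|||||||z z0 /sep//] := indep_sequence_common_kernel (f := fun x a => tr (x * a))
  subB _ _ _ _ xs finB yind.
- by move=> *; exact: mulrDl.
- by move=> *; exact: mulrDr.
- by move=> *; rewrite mulrA.
- exact: mulr1.
- by move=> *; exact: trace_fixed.
- by move=> *; rewrite mulrDr (trace_add actP).
- by move=> *; rewrite mulrA (trace_mulr actP).
Qed.

(** Elements of [E] are chosen with x_i x_j = 0 for i < j, each having the same annihilator as its
    square. Their right ideals are independent, so the choice stops. The sum of the chosen elements
    is then regular: a nonzero [b] that it kills would have a multiple in [E] to be chosen next. *)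
Lemma essential_right_ideal_regular (E : A -> Prop) :
  right_ideal B E -> (forall b, B b -> b <> 0 -> exists r, [/\ B r, b * r <> 0 & E (b * r)]) ->
  exists2 s, E s & forall b, B b -> s * b = 0 -> b = 0.
Proof.
move=> [EB E0 ED EM] ess.
(* The extra term [y] makes the invariant inductive: when [x] is appended, [x * r + y] takes its
   place and is shown to vanish; multiplying by [x] then isolates [x * (x * r)]. *)
pose C (l : seq A) := (forall e, e \in l -> E e) /\ forall r y, B r ->
  (forall e, e \in l -> e * y = 0) -> (\sum_(e <- l) e) * r + y = 0 ->
  forall e, e \in l -> e * r = 0.
pose P (l : seq A) x := [/\ E x, x <> 0, forall e, e \in l -> e * x = 0 &
  forall r, B r -> x * (x * r) = 0 -> x * r = 0].
have C0 : C [::] by [].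
have CS l x : C l -> P l x -> C (rcons l x).
  move=> [lE lC] [Ex x0 lx xx]; split=> [e|r y Br ly].
    by rewrite mem_rcons inE => /predU1P[->|/lE].
  have xy : x * y = 0 by apply: ly; rewrite mem_rcons mem_head.
  have {}ly e : e \in l -> e * y = 0 by move=> el; apply: ly; rewrite mem_rcons inE el orbT.
  rewrite big_rcons mulrDl -addrA => sr.
  have lr : forall e, e \in l -> e * r = 0.
    apply: lC sr => // e el.
    by rewrite mulrDr mulrA lx // mul0r ly // addr0.
  move=> e; rewrite mem_rcons inE => /predU1P[->|/lr//].
  apply: xx => //; have := congr1 (fun t => x * t) sr.
  rewrite mulr0 mulr_suml big_seq big1 => [|t /lr//].
  by rewrite add0r mulrDr xy addr0.
case: (pselect (forall l, C l -> exists x, P l x)) => [/(greedy_sequence C0 CS)[f fP]|nex].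
  have find : indep_sequence B *%R f.
    apply: (indep_sequence_triangular (f := fun i x => f i * x)) => [i x z|i|i j r _ lt|i r Br].
    - exact: mulrDr.
    - by have [] := fP i.
    - have [_ _ /(_ (f i)) + _] := fP j; rewrite mulrA => ->; first exact: mul0r.
      by apply: (map_f f); rewrite mem_iota.
    - by have [_ _ _] := fP i; apply.
  case: (fin_rudim_sequence (u := f) subB finB) => [n|n r Br r0].
    by have [/EB Bf f0 _ _] := fP n.
  by apply: (proj2 find) => //; rewrite big_mkord.
have [l [[lE lC] nx]] : exists l, C l /\ ~ exists x, P l x.
  by apply: contrapT => nl; apply: nex => l Cl; apply: contrapT => nx; apply: nl; exists l.
exists (\sum_(e <- l) e).
  by rewrite big_seq; apply: (big_ind E) => // e /lE.
move=> b Bb sb; apply: contrapT => b0; apply: nx.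
have {}lC e : e \in l -> e * b = 0.
  by apply: (lC b 0) => [|e' _|]; rewrite ?mulr0 ?addr0.
have [r [Br br0 Ebr]] := ess b Bb b0.
have [t [Bt brt0 brt]] :=
  exists_stable_multiple subB (fun _ h => h) primeB accB accB (EB _ Ebr) br0.
exists (b * r * t); split=> // [|e el]; first exact: EM.
by rewrite !mulrA lC // !mul0r.
Qed.

(** The right ideal of the [b] that carry [Z] into the module generated by [l] is essential: the
    elements of [Z] are treated one by one, each by a further multiple that stays nonzero. [l] does
    not depend on [Z]; its first entry [1] ensures that multiplying a space by [l] does not lower
    its dimension. *)
Lemma common_denominator : exists2 l : seq A, (0 < size l)%N /\ l`_0 = 1 &
  forall Z : seq A, exists s, [/\ B s, forall b, B b -> s * b = 0 -> b = 0 &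
    forall z, z \in Z -> fixed_comb l (z * s)].
Proof.
have [l0 l0P] := essential_finite_submodule; exists (1 :: l0) => // Z.
set l := 1 :: l0; have lP a : a <> 0 -> exists r, [/\ B r, a * r <> 0 & fixed_comb l (a * r)].
  by move=> /l0P[r [Br ar lr]]; exists r; split=> //; exact: fixed_comb_cons.
pose E b := B b /\ forall z, z \in Z -> fixed_comb l (z * b).
have comb0 : fixed_comb l 0.
  by exists (fun=> 0) => //; rewrite big1 // => i _; rewrite mulr0.
have [||s [Bs sZ] sreg] := @essential_right_ideal_regular E; last by exists s.
  split=> [b []//||x y [Bx xZ] [By yZ]|x r [Bx xZ] Br].
  - by split=> // z _; rewrite mulr0.
  - by split=> [|z zZ]; [exact: BD|rewrite mulrDr; apply: fixed_comb_add; auto].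
  - by split=> [|z zZ]; [exact: BM|rewrite mulrA; apply: fixed_comb_mulr; auto].
move=> b Bb b0; rewrite /E; elim: Z {E} => [|z Z [r [Br br0 [_ bZ]]]].
  by exists 1; rewrite mulr1.
suff [t [Bt brt zt]] : exists t, [/\ B t, b * r * t <> 0 & fixed_comb l (z * (b * r) * t)].
  exists (r * t); rewrite !mulrA; split=> //; first exact: BM.
  split=> [|z']; first by do 2?apply: BM.
  rewrite inE => /predU1P[->|/bZ]; first by rewrite !mulrA in zt *.
  by rewrite !mulrA => h; apply: fixed_comb_mulr.
case: (pselect (z * (b * r) = 0)) => [->|/lP[t [Bt zt lt]]].
  by exists 1; rewrite mulr1 mul0r.
by exists t; split=> // brt; apply: zt; rewrite -mulrA brt mulr0.
Qed.

End FinitenessOverFixedRing.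

(** * Growth estimates *)

Section Growth.
Variable R : realType.
Implicit Types (x y c d e : R).

(** A power t^e is t times t^(e-1), and the second factor does not increase with t. *)
Lemma powR_subadditive x y e : 0 < x -> 0 < y -> 0 <= e -> e <= 1 ->
  (x + y) `^ e <= x `^ e + y `^ e.
Proof.
move=> x0 y0 e0 e1; have xy0 : 0 < x + y by exact: addr_gt0.
have split1 t : 0 < t -> t `^ e = t * t `^ (e - 1).
  move=> t0; rewrite -{2}[t]powRr1 ?ltW // -powRD ?(gt_eqF t0) ?implybT //.
  by rewrite addrC subrK.
have mono t : 0 < t -> t <= x + y -> (x + y) `^ (e - 1) <= t `^ (e - 1).
  move=> t0 txy; rewrite -[e - 1]opprB !powRN lef_pV2 ?posrE ?powR_gt0 //.
  by apply: ge0_ler_powR; rewrite ?nnegrE ?subr_ge0 // ltW.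
rewrite (split1 _ xy0) (split1 _ x0) (split1 _ y0) mulrDl.
by apply: lerD; rewrite ler_pM2l // mono // ?lerDl ?lerDr ltW.
Qed.

(** Discrete form of the differential inequality f' >= c f^((d-1)/d), whose solutions grow at least
    like m^d. *)
Lemma powR_growth (f : nat -> R) c d : 0 < c -> 1 <= d -> 1 <= f 0%N ->
  (forall m, f m + c * f m `^ ((d - 1) / d) <= f m.+1) ->
  exists2 e, 0 < e & forall m, (e * m.+1%:R) `^ d <= f m.
Proof.
move=> c0 d1 f0 fS; have d0 : 0 < d by exact: lt_le_trans d1.
(* With x = e (m+1) and y = x + e <= 2x, convexity gives y^d - x^d <= d e y^(d-1) <= d e 2^(d-1)
   x^(d-1). The second bound on [e] makes this at most c x^(d-1); the bound 1 starts the
   induction. *)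
pose e := Num.min 1 (c / (d * 2 `^ (d - 1))).
have p2 : 0 < (2 : R) `^ (d - 1) by rewrite powR_gt0.
have e0 : 0 < e by rewrite lt_min ltr01 divr_gt0 // mulr_gt0.
have e1 : e <= 1 by rewrite ge_min lexx.
have ec : d * e * 2 `^ (d - 1) <= c.
  have : e <= c / (d * 2 `^ (d - 1)) by rewrite ge_min lexx orbT.
  by rewrite ler_pdivlMr ?mulr_gt0 // mulrCA mulrA.
exists e => //; elim=> [|m IH].
  rewrite mulr1; apply: le_trans f0; apply: le_trans (_ : 1 `^ d <= _).
    by apply: ge0_ler_powR; rewrite ?nnegrE ?ler01 ?(ltW d0) ?(ltW e0).
  by rewrite powR1.
apply: le_trans (fS m); set x := e * m.+1%:R in IH *; set y := e * m.+2%:R.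
have x0 : 0 < x by rewrite mulr_gt0 // ltr0n.
have yE : y = x + e by rewrite /y /x -[m.+2]addn1 natrD mulrDr mulr1.
have y0 : 0 < y by rewrite yE addr_gt0.
have y2x : y <= 2 * x.
  by rewrite yE mulr_natl mulr2n lerD2l /x ler_peMr ?ler1n // ltW.
(* The tangent inequality for the power d, obtained from Young's inequality with exponents d and
   d/(d-1); the latter requires d = 1 to be treated apart. *)
have young : d * (x * y `^ (d - 1)) <= x `^ d + (d - 1) * y `^ d.
  move: d1; rewrite le_eqVlt => /predU1P[<-|d1].
    by rewrite subrr powRr0 mul0r addr0 mul1r mulr1 powRr1 // ltW.
  have dm1 : 0 < d - 1 by rewrite subr_gt0.
  have q0 : 0 < d / (d - 1) by rewrite divr_gt0.
  have dq : d^-1 + (d / (d - 1))^-1 = 1.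
    by rewrite invf_div; field; rewrite gt_eqF.
  have := conjugate_powR (ltW x0) (powR_ge0 y (d - 1)) d0 q0 dq.
  have -> : (y `^ (d - 1)) `^ (d / (d - 1)) = y `^ d.
    by rewrite -powRrM mulrC divfK ?gt_eqF.
  rewrite -(ler_pM2l d0) => /le_trans; apply.
  by rewrite invf_div le_eqVlt; apply/orP; left; apply/eqP; field; rewrite gt_eqF.
have yd : y `^ d = y * y `^ (d - 1).
  by rewrite -{2}[y]powRr1 ?ltW // -powRD ?(gt_eqF y0) ?implybT // addrC subrK.
have step : y `^ d <= x `^ d + d * e * y `^ (d - 1).
  suff : d * (x * y `^ (d - 1)) + y `^ d <= x `^ d + (d - 1) * y `^ d + y `^ d.
    by move=> h; rewrite -subr_ge0; move: h; rewrite -subr_ge0 yd yE;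
       congr (is_true (0 <= _)); ring.
  by rewrite lerD2r.
have xd : x `^ (d - 1) <= f m `^ ((d - 1) / d).
  have -> : x `^ (d - 1) = (x `^ d) `^ ((d - 1) / d).
    by rewrite -powRrM mulrC divfK ?gt_eqF.
  apply: ge0_ler_powR => //; first by rewrite divr_ge0 ?subr_ge0 // ltW.
    by rewrite nnegrE powR_ge0.
  by rewrite nnegrE (le_trans (powR_ge0 _ _) IH).
apply: le_trans step _; apply: lerD => //.
apply: le_trans (_ : c * x `^ (d - 1) <= _); last by rewrite ler_pM2l.
apply: le_trans (_ : d * e * (2 * x) `^ (d - 1) <= _).
  rewrite ler_pM2l ?mulr_gt0 //; apply: ge0_ler_powR => //.
  - by rewrite subr_ge0.
  - by rewrite nnegrE ltW.
  - by rewrite nnegrE mulr_ge0 // ltW.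
by rewrite powRM ?ler0n ?(ltW x0) // mulrA ler_pM2r ?powR_gt0.
Qed.

Lemma limn_esup_ge (u : nat -> \bar R) (x : \bar R) :
  (forall n, exists2 m, (n <= m)%N & (x <= u m)%E) -> (x <= limn_esup u)%E.
Proof.
move=> ux; apply: le_ereal_inf_tmp => _ [V [n _ nV] <-].
have [m nm xm] := ux n; apply: le_trans xm _.
by apply: ereal_sup_ubound; exists m => //; apply: nV.
Qed.

Lemma limn_esup_log_ge (f : nat -> R) d e : 0 <= d -> 0 < e ->
  (forall m, (e * m.+1%:R) `^ d <= f m) ->
  (d%:E <= limn_esup (fun m : nat => (ln (f m) / ln (m%:R : R))%:E))%E.
Proof.
move=> d0 e0 ef; apply/lee_subgt0Pr => t t0; apply: limn_esup_ge => n.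
(* Since ln (f m) >= d (ln e + ln m), the quotient loses at most d |ln e| / ln m, which is at most
   [t] once ln m >= [K]. *)
pose K := d * `|ln e| / t.
have [m0 m0K] : exists m0 : nat, expR K <= m0%:R.
  by exists (Num.trunc (expR K)).+1; rewrite ltW // truncnS_gt.
pose m := maxn (maxn n m0) 2; exists m; first by rewrite /m !leq_max leqnn.
have m2 : (1 < m)%N by rewrite /m leq_max orbT.
have mpos : 0 < (m%:R : R) by rewrite ltr0n ltnW.
have lnm : 0 < ln (m%:R : R) by rewrite ln_gt0 // ltr1n.
have Km : K <= ln (m%:R : R).
  rewrite -(expRK K) ler_ln ?posrE ?expR_gt0 //; apply: le_trans m0K _.
  by rewrite ler_nat /m !leq_max leqnn orbT.
rewrite -EFinB lee_fin ler_pdivlMr //.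
have em : 0 < e * m.+1%:R by rewrite mulr_gt0 // ltr0n.
have le1 : d * (ln e + ln (m%:R : R)) <= ln (f m).
  apply: le_trans (_ : ln ((e * m.+1%:R) `^ d) <= _); last first.
    have pw : 0 < (e * m.+1%:R) `^ d by rewrite powR_gt0.
    by rewrite ler_ln ?posrE // (lt_le_trans pw).
  rewrite ln_powR ler_wpM2l // lnM ?posrE ?ltr0n // lerD2l.
  by rewrite ler_ln ?posrE ?mpos ?ltr0n // ler_nat.
apply: le_trans le1; rewrite mulrBl mulrDr addrC lerD2r -mulrN1.
have : d * `|ln e| <= t * ln (m%:R : R) by rewrite [leRHS]mulrC -ler_pdivrMr.
have : - `|ln e| <= ln e by rewrite lerNl -normrN ler_norm.
by move=> /(ler_wpM2l d0); lra.
Qed.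

End Growth.

(** * Lower transcendence degree *)

Section LowerTranscendenceDegree.
Variables (k : fieldType) (A : algType k).
Implicit Types (S : A -> Prop) (v w l : seq A) (d : RR).

Lemma sdim_vmul_subframe S v w : subframe S v -> (sdim w <= sdim (vmul v w))%N.
Proof.
move=> [_ v1]; apply: sdim_leq => x xw; rewrite -[x]mul1r.
exact/vmul_span/in_span_mem.
Qed.

Lemma LD_exps_strict S v w d : LD_exps S v d -> nz_fdsub S w ->
  (sdim w < sdim (vmul v w))%N.
Proof.
move=> [d0 [c [c0 h]]] wS; rewrite -(ltr_nat RR); apply: lt_le_trans (h _ wS).
by rewrite ltrDl mulr_gt0 // powR_gt0 // ltr0n; case: wS.
Qed.

(** At exponent 1 the power is the zeroth, so [c = 1] asks for one more dimension, which is what a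
    strict inequality of integers gives. *)
Lemma LD_exps1 S v : (forall w, nz_fdsub S w -> (sdim w < sdim (vmul v w))%N) ->
  LD_exps S v 1.
Proof.
move=> lt; split; first exact: ltr01.
exists 1; split; first exact: ltr01.
move=> w /lt ltw; rewrite subrr mul0r powRr0 mulr1.
by rewrite -[X in _ + X]/(1%:R) -natrD ler_nat addn1.
Qed.

Lemma LDdeg_exps S v d : subframe S v -> LD_exps S v d -> (d%:E <= LDdeg S)%E.
Proof.
move=> Sv dv; rewrite /LDdeg; case: ifPn => [/asboolP/(_ v Sv)[w [wS E]]|_].
  by have := LD_exps_strict dv wS; rewrite E ltnn.
apply: le_trans (_ : ereal_sup [set d%:E | d in LD_exps S v] <= _)%E.
  by apply: ereal_sup_ubound; exists d.
by apply: ereal_sup_ubound; exists v.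
Qed.

(** Outside the zero branch some [v] makes every dimension grow strictly, so the supremum is not
    minus infinity. *)
Lemma LDdeg_cases S : LDdeg S = 0%E \/ exists2 v, subframe S v & LD_exps S v 1.
Proof.
rewrite /LDdeg; case: ifPn => [_|/asboolP nex]; [by left|right].
apply: contrapT => nv; apply: nex => v Sv; apply: contrapT => nw; apply: nv.
exists v => //; apply: LD_exps1 => w wS; rewrite ltn_neqAle (sdim_vmul_subframe _ Sv) andbT.
by apply/eqP => E; apply: nw; exists w.
Qed.

Lemma LDdeg_ge0 S : (0 <= LDdeg S)%E.
Proof.
have [->//|[v Sv v1]] := LDdeg_cases S.
by apply: le_trans (LDdeg_exps Sv v1); rewrite lee_fin ler01.
Qed.

(** Any exponent of [v] forces strict growth and thereby yields the exponent 1 as well, so the bound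
    at 1 covers all exponents below 1. *)
Lemma LDdeg_le S (x : \bar RR) : (0 <= x)%E ->
  (forall v d, subframe S v -> LD_exps S v d -> 1 <= d -> (d%:E <= x)%E) ->
  (LDdeg S <= x)%E.
Proof.
move=> x0 ub; rewrite /LDdeg; case: ifP => // _.
apply: ge_ereal_sup => _ [v Sv <-]; apply: ge_ereal_sup => _ [d dv <-].
have [d1|d1] := leP 1 d; first exact: ub dv d1.
have v1 : LD_exps S v 1 by apply: LD_exps1 => w; exact: LD_exps_strict dv.
by apply: le_trans (ub v 1 Sv v1 (lexx _)); rewrite lee_fin ltW.
Qed.

Lemma vpow_mem S v m : subalg S -> (forall x, x \in v -> S x) ->
  forall x, x \in vpow v m -> S x.
Proof.
move=> [S1 _ SM _] Sv; elim: m => [|m IH] x /=; first by rewrite inE => /eqP->.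
by move=> /allpairsP[[y z] [/= /IH Sy /Sv Sz ->]]; exact: SM.
Qed.

(** [vpow] multiplies by [v] on the right, [LD_exps] on the left; associativity reconciles them. *)
Lemma sdim_vpowS v m : (sdim (vmul v (vpow v m)) <= sdim (vpow v m.+1))%N.
Proof.
apply: sdim_leq => _ /allpairsP[[x y] [/= xv + ->]].
elim: m y => [|m IH] y.
  rewrite inE => /eqP->; rewrite mulr1 -[x]mul1r.
  by apply/in_span_mem/allpairs_f; rewrite ?inE.
move=> /allpairsP[[y' z] [/= y'm zv ->]]; rewrite mulrA.
by apply: vmul_span; [exact: IH|exact: in_span_mem].
Qed.

Lemma sdim_vpow_gt0 S v m : subframe S v -> (0 < sdim (vpow v m))%N.
Proof.
move=> Sv; elim: m => [|m IH].
  by apply/sdim_gt0; exists 1; [exact: mem_head|exact/eqP/oner_neq0].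
apply: leq_trans IH (leq_trans _ (sdim_vpowS v m)).
exact: sdim_vmul_subframe Sv.
Qed.

Lemma GKdim_ge0 S : subalg S -> (0 <= GKdim S)%E.
Proof.
move=> [S1 _ _ _]; have Sv : subframe S [:: 1].
  by split=> [x|]; [rewrite inE => /eqP->|exact/in_span_mem/mem_head].
apply: le_trans (_ : limn_esup (fun m : nat =>
    ((ln (sdim (vpow [:: 1 : A] m))%:R / ln (m%:R : RR))%:E)) <= _)%E; last first.
  by apply: ereal_sup_ubound; exists [:: 1].
apply: limn_esup_ge => n; exists n.+1; first exact: leqnSn.
rewrite lee_fin divr_ge0 ?ln_ge0 ?ler1n //.
exact: sdim_vpow_gt0 Sv.
Qed.

Lemma GKdim_exps S v d : subalg S -> subframe S v -> LD_exps S v d -> 1 <= d ->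
  (d%:E <= GKdim S)%E.
Proof.
move=> subS Sv [d0 [c [c0 h]]] d1.
have [|m|e e0 ef] := @powR_growth RR (fun m => (sdim (vpow v m))%:R) c d c0 d1.
- by rewrite ler1n; exact: sdim_vpow_gt0 Sv.
- apply: le_trans (h (vpow v m) _) _; last by rewrite ler_nat; exact: sdim_vpowS.
  split; last exact: sdim_vpow_gt0 Sv.
  by apply: vpow_mem => //; case: Sv.
apply: le_trans (limn_esup_log_ge (ltW d0) e0 ef) _.
by apply: ereal_sup_ubound; exists v.
Qed.

Lemma LDdeg_le_GKdim S : subalg S -> (LDdeg S <= GKdim S)%E.
Proof.
move=> subS; apply: LDdeg_le; first exact: GKdim_ge0.
by move=> v d; exact: GKdim_exps.
Qed.

Lemma GKdim_mono S T : set_sub S T -> (GKdim S <= GKdim T)%E.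
Proof.
move=> ST; apply: ereal_sup_le => _ [v [Sv v1] <-]; exists v => //.
by split=> // x /Sv/ST.
Qed.

End LowerTranscendenceDegree.

(** * Lower transcendence degrees of A and of its fixed ring *)

Section FixedRingDegree.
Variables (k : fieldType) (A : algType k) (gT : finGroupType) (act : gT -> A -> A).
Hypotheses (actP : faithful_alg_action act) (char0 : [pchar k] =i pred0)
  (pgA : prime_goldie (whole A)) (pgB : prime_goldie (fixed_ring act)).
Local Notation B := (fixed_ring act).
Local Notation tr := (trace act).

Let subB : subalg B. Proof. exact: fixed_subalg. Qed.
Let BM x y : B x -> B y -> B (x * y). Proof. by case: subB => _ _ + _; apply. Qed.

(* Rank-nullity along the left [B]-linear maps [tr (_ * x)] reduces a subspace of [A] to subspaces of [B]. *)
Lemma LD_exps_whole v d : subframe B v -> 1 <= d -> LD_exps B v d ->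
  LD_exps (whole A) v d.
Proof.
move=> [Bv _] d1 [d0 [c [c0 h]]]; split=> //; exists c; split=> // w [_].
have e0 : 0 <= (d - 1) / d by rewrite divr_ge0 ?subr_ge0 // ltW.
have e1 : (d - 1) / d <= 1 by rewrite ler_pdivrMr // mul1r gerBl.
set e := (d - 1) / d in h e0 e1 *.
elim: {w}(sdim w) {-2}w (leqnn (sdim w)) => [|n IH] w wn w0.
  by move: w0; rewrite ltnNge wn.
have /sdim_gt0[a aw a0] := w0.
have [x ax] : exists x, tr (a * x) <> 0.
  apply: contrapT => nx; apply/a0/(trace_nondegenerate_right actP char0 (proj1 pgA)) => x.
  by apply: contrapT => ax; apply: nx; exists x.
pose f y := tr (y * x).
have fL : linear f by move=> t y z; rewrite /f mulrDl -scalerAl trace_linear.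
have [l lP wl] := sdim_kernel fL w.
have lw := sdim_kernel_le fL lP.
have fw0 : (0 < sdim (map f w))%N.
  by apply/sdim_gt0; exists (f a) => //; exact: map_f.
have fv y z : y \in v -> f (y * z) = y * f z.
  by move=> yv; rewrite /f -mulrA trace_mull //; exact: Bv.
have lvw y : y \in vmul v l -> in_span (vmul v w) y /\ f y = 0.
  move=> /allpairsP[[t z] [/= tv zl ->]]; have [wz fz] := lP z zl.
  by rewrite fv // fz mulr0; split=> //; apply: vmul_span => //; exact: in_span_mem.
(* By linearity over B, [f] maps V W onto V f(W), while V times the kernel stays in the kernel: the
   two growths add up inside V W. *)
have vfw : (sdim (vmul v (map f w)) + sdim (vmul v l) <= sdim (vmul v w))%N.
  apply: leq_trans (sdim_kernel_le fL lvw); rewrite leq_add2r; apply: sdim_subset => y.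
  move=> /allpairsP[[t z] [/= tv /mapP[u uw ->] ->]]; rewrite -fv //.
  exact/map_f/allpairs_f.
have hf : (sdim (map f w))%:R + c * (sdim (map f w))%:R `^ e <=
    (sdim (vmul v (map f w)))%:R :> RR.
  by apply: h; split=> // y /mapP[z _ ->]; exact: trace_fixed.
have pos m : (0 < m)%N -> 0 < (m%:R : RR) by rewrite ltr0n.
rewrite -(ler_nat RR) in vfw; apply: le_trans vfw; rewrite natrD.
have [l0|l0] := posnP (sdim l).
  rewrite l0 addn0 in wl; have -> : sdim w = sdim (map f w).
    by apply/eqP; rewrite eqn_leq wl sdim_map_le.
  by apply: le_trans hf _; rewrite lerDl ler0n.
have hl : (sdim l)%:R + c * (sdim l)%:R `^ e <= (sdim (vmul v l))%:R :> RR.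
  by apply: IH => //; rewrite -ltnS; apply: leq_trans wn; apply: leq_trans lw;
     rewrite -[X in (X < _)%N]add0n ltn_add2r.
have -> : sdim w = (sdim (map f w) + sdim l)%N by apply/eqP; rewrite eqn_leq wl.
(* Subadditivity of the power lets the same [c] serve for both pieces together, so the induction
   loses no constant. *)
apply: le_trans (lerD hf hl); rewrite natrD addrACA lerD2l -mulrDr ler_pM2l //.
by apply: powR_subadditive => //; exact: pos.
Qed.

(* With [M = sum_i a_i B] and [s] a common denominator of [v a_i], put [W' = sum_i a_i s W]: then [v W'] is in [sum_i a_i V' W], so [dim v W' - dim W'] is at most [n (dim V' W - dim s W)]. *)
Lemma LD_exps_fixed v d : 1 <= d -> LD_exps (whole A) v d ->
  exists2 v', subframe B v' & LD_exps B v' d.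
Proof.
move=> d1 [d0 [c [c0 h]]].
have [l [l0 l1] den] := common_denominator actP char0 pgA pgB.
have [s [Bs sreg sZ]] := den (vmul v l).
have /choice[b bP] z : exists b : nat -> A, (forall i, B (b i)) /\
    (z \in vmul v l -> z * s = \sum_(0 <= i < size l) l`_i * b i).
  case: (boolP (z \in vmul v l)) => [/sZ[b Bb zE]|_]; first by exists b.
  by exists (fun=> 0); split=> // i g; exact: act_zero.
(* [1] makes [v'] a subframe, [s] puts s W inside V' W, and the [b z i] are the coefficients of
   [z * s] on [l]. *)
pose v' := 1 :: s :: [seq b z i | z <- vmul v l, i <- iota 0 (size l)].
exists v'.
  split; last exact/in_span_mem/mem_head.
  move=> x; rewrite !inE => /orP[/eqP->|/orP[/eqP->//|]]; first by case: subB.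
  by move=> /allpairsP[[z i] [_ _ ->]]; have [] := bP z.
have n0 : 0 < ((size l)%:R : RR) by rewrite ltr0n.
split=> //; exists (c / (size l)%:R); split; first exact: divr_gt0.
move=> w [Bw w0]; pose q := [seq s * x | x <- w].
have sqw : sdim q = sdim w.
  apply: sdim_map_inj => [|x wx]; first by move=> a y z; rewrite mulrDr scalerAr.
  apply: sreg; have [_ BD _ BZ] := subB; apply: (in_span_closed _ BD BZ Bw wx).
  by move=> g; exact: act_zero.
have qp x : x \in q -> in_span (vmul v' w) x.
  by move=> /mapP[y yw ->]; apply/in_span_mem/allpairs_f; rewrite // !inE eqxx orbT.
have [C Csize spanC] := sdim_extend qp.
have ql : (sdim q <= sdim (vmul l q))%N.
  apply: sdim_subset => x xq; rewrite -[x]mul1r -l1.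
  by apply/allpairs_f => //; exact: mem_nth.
have hl : (sdim (vmul l q))%:R + c * (sdim (vmul l q))%:R `^ ((d - 1) / d) <=
    (sdim (vmul v (vmul l q)))%:R :> RR.
  by apply: h; split=> //; apply: leq_trans ql; rewrite sqw.
(* The product lies in [l] times V' W, that is, in the span of [l q] and [l C]; only the
   [size l * size C] products from [l C] can be new, whence the division of [c] by [size l]. *)
have vl : (sdim (vmul v (vmul l q)) <= sdim (vmul l q) + size l * size C)%N.
  have -> : (size l * size C)%N = size (vmul l C) by rewrite size_allpairs.
  have cat : (sdim (vmul l q ++ vmul l C) <= sdim (vmul l q) + size (vmul l C))%N.
    by apply: leq_trans (sdim_cat _ _) _; rewrite leq_add2l sdim_size.
  apply: leq_trans cat.
  apply: sdim_leq => _ /allpairsP[[x y] [/= xv /allpairsP[[a z] [/= al /mapP[t tw ->] ->]] ->]].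
  have [_ /(_ (allpairs_f _ xv al))E] := bP (x * a).
  rewrite !mulrA E mulr_suml big_seq_cond; apply: big_ind => [||i].
  - exact: in_span0.
  - exact: in_spanD.
  rewrite andbT mem_index_iota => /andP[_ il]; rewrite -mulrA.
  have bt : in_span (C ++ q) (b (x * a) i * t).
    apply: spanC; apply: allpairs_f => //; rewrite !inE; apply/orP; right; apply/orP; right.
    by apply: allpairs_f; [exact: allpairs_f|rewrite mem_iota].
  apply: in_span_subset (vmul_span (in_span_mem (mem_nth 0 il)) bt) => u.
  move=> /allpairsP[[y' z'] [/= y'l + ->]]; rewrite !mem_cat => /orP[z'C|z'q].
    by rewrite (allpairs_f _ y'l z'C) orbT.
  by rewrite (allpairs_f _ y'l z'q).
have mono : (sdim w)%:R `^ ((d - 1) / d) <= (sdim (vmul l q))%:R `^ ((d - 1) / d) :> RR.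
  apply: ge0_ler_powR; rewrite ?nnegrE ?ler0n //; first by rewrite divr_ge0 ?subr_ge0 // ltW.
  by rewrite -sqw ler_nat.
rewrite -Csize sqw natrD addrC lerD2r mulrAC ler_pdivrMr // mulrC [leRHS]mulrC.
rewrite -natrM.
move: vl; rewrite -(ler_nat RR) natrD => vl.
have := le_trans hl vl; rewrite lerD2l => {}hl.
by apply: le_trans hl; rewrite mulrC ler_pM2l.
Qed.

Lemma LDdeg_fixed : LDdeg (whole A) = LDdeg B.
Proof.
apply/eqP; rewrite eq_le; apply/andP; split; apply: LDdeg_le; try exact: LDdeg_ge0.
  by move=> v d _ vd d1; have [v' Bv'] := LD_exps_fixed d1 vd; exact: LDdeg_exps.
move=> v d Bv vd d1; apply: LDdeg_exps (LD_exps_whole Bv d1 vd).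
by case: Bv.
Qed.

End FixedRingDegree.

Theorem theorem4p4 (k : fieldType) (A : algType k) (gT : finGroupType)
    (act : gT -> A -> A) :
  [pchar k] =i pred0 ->
  prime_goldie (whole A) ->
  faithful_alg_action act ->
  trace_nondeg act \/ reduced A ->
  prime_goldie (fixed_ring act) ->
  LDdeg (whole A) = LDdeg (fixed_ring act) /\
  (LD_stable (whole A) -> LD_stable (fixed_ring act)).
Proof.
move=> char0 pgA actP _ pgB; have LDE := LDdeg_fixed actP char0 pgA pgB.
split=> // stable; apply/eqP; rewrite eq_le LDdeg_le_GKdim; last exact: fixed_subalg.
by rewrite -LDE stable GKdim_mono.
Qed.
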